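(* Let $J=\{1,\dots,m\}$ and, for each $j\in J$, let $\alpha_j\in(0,1)$ and let $T_j\colon X\rightrightarrows X$ be union $\alpha_j$-averaged nonexpansive (resp. union nonexpansive). Then the following assertions hold. (a) The operator $T\colon X\rightrightarrows X$ defined by $T(x):=\bigcup_{j\in J}T_j(x)$ is union $\alpha$-averaged nonexpansive with $\alpha:=\max_{j\in J}\alpha_j$ (resp. union nonexpansive). (b) Whenever $\omega_j>0$ for all $j\in J$ and $\sum_{j\in J}\omega_j=1$, the operator $\sum_{j\in J}\omega_jT_j$ is union $\alpha$-averaged nonexpansive with $\alpha:=\sum_{j\in J}\omega_j\alpha_j$ (resp. union nonexpansive). (c) The operator $T_m\circ\dots\circ T_2\circ T_1$ is union $\alpha$-averaged nonexpansive with $$\alpha:=\left(1+\left(\sum_{j\in J}\frac{\alpha_j}{1-\alpha_j}\right)^{-1}\right)^{-1}$$ (resp. union nonexpansive).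
   Context: $X$ is a real finite-dimensional Hilbert space with inner product $\langle\cdot,\cdot\rangle$ and norm $\|\cdot\|$. A single-valued $T\colon X\to X$ is nonexpansive if $\|Tx-Ty\|\le\|x-y\|$ for all $x,y\in X$, and $\alpha$-averaged nonexpansive if $\alpha\in(0,1)$ and $\|Tx-Ty\|^2+\frac{1-\alpha}{\alpha}\|(\operatorname{Id}-T)x-(\operatorname{Id}-T)y\|^2\le\|x-y\|^2$ for all $x,y\in X$. A set-valued map $\varphi\colon X\rightrightarrows Y$ is outer semicontinuous (osc) at $\bar x$ if, whenever $x_n\to\bar x$ and $y_n\to y$ with $y_n\in\varphi(x_n)$, one has $y\in\varphi(\bar x)$; it is osc if it is osc at every point. Finite index sets carry the discrete topology. A set-valued operator $T\colon X\rightrightarrows X$ is union $\alpha$-averaged nonexpansive (resp. union nonexpansive) if it can be written as $T(x)=\{T_i(x): i\in\varphi(x)\}$ for all $x\in X$, where $I$ is a finite index set, $\{T_i\}_{i\in I}$ is a collection of (single-valued) $\alpha$-averaged nonexpansive (resp. nonexpansive) operators on $X$, and $\varphi\colon X\rightrightarrows I$ is osc with nonempty values. Sums of sets are Minkowski sums: $(\sum_j\omega_jT_j)(x)=\sum_j\omega_jT_j(x)$. Composition of set-valued operators: $(S\circ T)(x)=\bigcup_{y\in T(x)}S(y)$. *)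

(* Defs.v *)
From HB Require Import structures.
From mathcomp Require Import all_boot all_order all_algebra.
From mathcomp Require Import all_classical all_reals all_analysis.
Set Implicit Arguments.
Unset Strict Implicit.
Unset Printing Implicit Defensive.
Import Order.TTheory GRing.Theory Num.Theory.
Import numFieldNormedType.Exports.
Local Open Scope classical_set_scope.
Local Open Scope ring_scope.

(* The norm, hence the topology, is the one of [normedModType]; [inner_norm]
   ties the inner product to it and also gives positive definiteness.
   [Vector] provides finite dimension, hence completeness. *)
HB.mixin Record NormedModule_isInner (R : realType) V
    of NormedModule R V := {
  inner : V -> V -> R ;
  innerC : forall x y, inner x y = inner y x ;
  innerDl : forall x y z, inner (x + y) z = inner x z + inner y z ;
  innerZl : forall (a : R) x y, inner (a *: x) y = a * inner x y ;
  inner_norm : forall x, inner x x = `|x| ^+ 2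
}.

#[short(type="finHilbertType")]
HB.structure Definition FinHilbert (R : realType) :=
  { V of NormedModule R V & Vector R V & NormedModule_isInner R V }.

Definition osc_at (X Y : topologicalType) (phi : X -> set Y) (a : X) : Prop :=
  forall (x : nat -> X) (y : nat -> Y) (b : Y),
    x n @[n --> \oo] --> a -> y n @[n --> \oo] --> b ->
    (forall n, phi (x n) (y n)) -> phi a b.

Definition osc (X Y : topologicalType) (phi : X -> set Y) : Prop :=
  forall a, osc_at phi a.

Section operators.
Variables (R : realType) (X : finHilbertType R).

Definition nonexpansive (T : X -> X) : Prop :=
  forall x y, `|T x - T y| <= `|x - y|.

Definition averaged (alpha : R) (T : X -> X) : Prop :=
  0 < alpha < 1 /\
  forall x y, `|T x - T y| ^+ 2
    + (1 - alpha) / alpha * `|(x - T x) - (y - T y)| ^+ 2 <= `|x - y| ^+ 2.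

Definition union_of (P : (X -> X) -> Prop) (T : X -> set X) : Prop :=
  exists (I : finType) (f : I -> X -> X) (phi : X -> set (discrete_topology I)),
    [/\ forall i, P (f i),
        osc phi,
        forall x, phi x !=set0 &
        forall x, T x = [set f i x | i in phi x]].

Definition union_averaged (alpha : R) (T : X -> set X) : Prop :=
  union_of (averaged alpha) T.

Definition union_nonexpansive (T : X -> set X) : Prop :=
  union_of nonexpansive T.

Definition minkowski_add (A B : set X) : set X := [set a + b | a in A & b in B].

Definition minkowski_scale (k : R) (A : set X) : set X := [set k *: a | a in A].

Definition union_op (m : nat) (T : 'I_m -> X -> set X) : X -> set X :=
  fun x => \bigcup_(j in [set: 'I_m]) T j x.

Definition combination (m : nat) (w : 'I_m -> R) (T : 'I_m -> X -> set X) :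
    X -> set X :=
  fun x => \big[minkowski_add/[set 0]]_(j < m) minkowski_scale (w j) (T j x).

Definition set_comp (S T : X -> set X) : X -> set X :=
  fun x => \bigcup_(y in T x) S y.

(* T_(m-1) o ... o T_1 o T_0: the operator of index 0 is applied first. *)
Definition composition (m : nat) (T : 'I_m -> X -> set X) : X -> set X :=
  foldl (fun S j => set_comp (T j) S) (fun x => [set x]) (enum 'I_m).

End operators.

(* Main.v *)
Require Import Defs.
From HB Require Import structures.
From mathcomp Require Import all_boot all_order all_algebra.
From mathcomp Require Import all_classical all_reals all_analysis.
From mathcomp Require Import ring lra.
Set Implicit Arguments.
Unset Strict Implicit.
Unset Printing Implicit Defensive.
Import Order.TTheory GRing.Theory Num.Theory.
Import numFieldNormedType.Exports.
Local Open Scope classical_set_scope.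
Local Open Scope ring_scope.

(** Two independent mechanisms combine.

    The combinatorial one concerns unions. As the index set is
    discrete, outer semicontinuity of the selector [phi] says exactly that
    each region [phi x i], for a fixed index [i], is sequentially closed
    ([osc_discreteP]). Unions, Minkowski sums and compositions of two union
    operators are again union operators, indexed by the disjoint union, the
    product and the product of the two index sets. The new regions are the old
    ones, intersections of old ones, or, for a composition, an intersection
    with a preimage under a selected operator of the inner map; such a preimage
    stays closed because nonexpansive operators are continuous
    ([union_of_setU], [union_of_minkowski_add], [union_of_comp]). The [m]-ary
    operations follow by induction.

    The metric one says how single-valued operators behave, and each operation
    is served by its own description of averagedness, chosen so that an
    induction through partial results stays inside the class.
    - For unions and convex combinations: [g] is [a]-averaged iff
      [g = (1 - a) Id + a N] with [N] nonexpansive. The class [relaxed w b] of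
      the operators [(w - b) Id + b N] is stable under addition and
      nonnegative scaling, with [w] and [b] transforming accordingly, and
      [relaxed 1 a] grows with [a]. Moreover [relaxed 1 1] is the class of
      nonexpansive operators, so that both halves of the claim on
      combinations are one and the same computation.
    - For compositions: with [s = a / (1 - a)], [g] is [a]-averaged iff the
      squared displacement difference is at most [s] times the loss of squared
      distance. By the Cauchy-Schwarz inequality the constants [s] add up under
      composition ([displacement_bounded_comp]), and [a] is recovered from
      the sum of the [s] as [(1 + s^-1)^-1]. *)

(** * Outer semicontinuity into a discrete space *)

Definition seq_closed (X : topologicalType) (A : set X) : Prop :=
  forall (u : nat -> X) (a : X),
    u n @[n --> \oo] --> a -> (forall n, A (u n)) -> A a.

(** A sequence converging in a discrete space is eventually constant, so up to
    dropping finitely many terms only one index is involved. *)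
Lemma osc_discreteP (X : topologicalType) (I : choiceType)
    (phi : X -> set (discrete_topology I)) :
  osc phi <-> forall i : I, seq_closed [set x | phi x i].
Proof.
split=> [osc_phi i u a ua phi_u | closed_phi a x y b xa yb phi_xy].
  by apply: (osc_phi a u (fun=> i)) => //; exact: cvg_cst.
have /yb [N _ yN] := discrete_set1 b.
apply: (closed_phi b (fun n => x (n + N)%N));
  first exact: cvg_comp (@cvg_addnr N) xa.
by move=> n /=; rewrite -(yN (n + N)%N) //= leq_addl.
Qed.

(** * Operations on unions of operators *)

Section unions.
Variables (R : realType) (X : finHilbertType R).
Implicit Types (P Q : (X -> X) -> Prop) (S T : X -> set X) (g h : X -> X).

Lemma nonexpansive_cvg g (u : nat -> X) (a : X) :
  nonexpansive g -> u n @[n --> \oo] --> a -> g (u n) @[n --> \oo] --> g a.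
Proof.
move=> ne_g ua; apply/cvgrPdist_lt => e e_gt0.
move/cvgrPdist_lt/(_ e e_gt0): ua; apply: filterS => n.
exact: le_lt_trans.
Qed.

Lemma union_of_sub P Q T :
  (forall g, P g -> Q g) -> union_of P T -> union_of Q T.
Proof.
move=> PQ [I [f [phi [Pf osc_phi ne_phi TE]]]].
by exists I, f, phi; split=> // i; apply: PQ.
Qed.

Lemma union_of_set1 P g : P g -> union_of P (fun x => [set g x]).
Proof.
move=> Pg; exists unit, (fun=> g), (fun=> setT); split=> //.
- by exists tt.
- by move=> x; apply/seteqP; split=> [_ -> | _ [_ _ <-]] //; exists tt.
Qed.

Lemma union_of_setU P S T :
  union_of P S -> union_of P T -> union_of P (fun x => S x `|` T x).
Proof.
move=> [I [f [phi [Pf /osc_discreteP cl_phi ne_phi SE]]]].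
move=> [J [g [psi [Pg /osc_discreteP cl_psi ne_psi TE]]]].
exists (I + J)%type, (fun k => match k with inl i => f i | inr j => g j end).
exists (fun x k => match k with inl i => phi x i | inr j => psi x j end).
split.
- by case.
- by apply/osc_discreteP => -[i | j]; [exact: cl_phi | exact: cl_psi].
- by move=> x; have [i] := ne_phi x; exists (inl i).
- move=> x; rewrite SE TE; apply/seteqP; split=> y.
    by move=> [[i phi_i <-] | [j psi_j <-]]; [exists (inl i) | exists (inr j)].
  by move=> [[i | j] /= ij <-]; [left; exists i | right; exists j].
Qed.

Lemma union_of_minkowski_add {P Q} P' S T :
    (forall g h, P g -> Q h -> P' (fun x => g x + h x)) ->
  union_of P S -> union_of Q T ->
  union_of P' (fun x => minkowski_add (S x) (T x)).
Proof.
move=> PQ [I [f [phi [Pf /osc_discreteP cl_phi ne_phi SE]]]].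
move=> [J [g [psi [Qg /osc_discreteP cl_psi ne_psi TE]]]].
exists (I * J)%type, (fun k x => f k.1 x + g k.2 x).
exists (fun x k => phi x k.1 /\ psi x k.2); split.
- by move=> k; apply: PQ.
- apply/osc_discreteP => -[i j] u a ua phi_psi_u; split=> /=.
    by apply: (cl_phi i u) => // n; have [] := phi_psi_u n.
  by apply: (cl_psi j u) => // n; have [] := phi_psi_u n.
- move=> x; have [i phi_i] := ne_phi x; have [j psi_j] := ne_psi x.
  by exists (i, j).
- move=> x; rewrite SE TE; apply/seteqP; split=> y.
    move=> [_ [i phi_i <-] [_ [j psi_j <-] <-]].
    by exists (i, j).
  move=> [[i j] [phi_i psi_j] <-].
  by exists (f i x); [exists i | exists (g j x); [exists j |]].
Qed.

Lemma union_of_minkowski_scale {P} P' (k : R) T :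
    (forall g, P g -> P' (fun x => k *: g x)) ->
  union_of P T -> union_of P' (fun x => minkowski_scale k (T x)).
Proof.
move=> PP' [I [f [phi [Pf osc_phi ne_phi TE]]]].
exists I, (fun i x => k *: f i x), phi; split=> // [i | x]; first exact: PP'.
by rewrite TE /minkowski_scale image_comp.
Qed.

(** The pair [(i, j)] is active at [x] when [i] is active at [x] and [j] is
    active at [f i x]; the nonexpansiveness of [f i] makes the second condition
    closed in [x]. *)
Lemma union_of_comp {P Q} P' S T :
    (forall g, P g -> nonexpansive g) ->
    (forall g h, P g -> Q h -> P' (h \o g)) ->
  union_of P S -> union_of Q T -> union_of P' (set_comp T S).
Proof.
move=> ne_P PQ [I [f [phi [Pf /osc_discreteP cl_phi ne_phi SE]]]].
move=> [J [g [psi [Qg /osc_discreteP cl_psi ne_psi TE]]]].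
exists (I * J)%type, (fun k => g k.2 \o f k.1).
exists (fun x k => phi x k.1 /\ psi (f k.1 x) k.2); split.
- by move=> k; apply: PQ.
- apply/osc_discreteP => -[i j] u a ua phi_psi_u; split=> /=.
    by apply: (cl_phi i u) => // n; have [] := phi_psi_u n.
  apply: (cl_psi j (f i \o u)); first exact/nonexpansive_cvg/ua/ne_P.
  by move=> n; have [] := phi_psi_u n.
- move=> x; have [i phi_i] := ne_phi x; have [j psi_j] := ne_psi (f i x).
  by exists (i, j).
- move=> x; rewrite /set_comp SE; apply/seteqP; split=> y.
    by move=> [_ [i phi_i <-]]; rewrite TE => -[j psi_j <-]; exists (i, j).
  move=> [[i j] [phi_i psi_j] <-].
  by exists (f i x); [exists i | rewrite TE; exists j].
Qed.

Lemma union_of_union_op P (m : nat) (T : 'I_m -> X -> set X) :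
  (0 < m)%N -> (forall j, union_of P (T j)) -> union_of P (union_op T).
Proof.
case: m T => // m T _ uT.
(* Repeating [ord0] keeps the family nonempty at every stage: the empty
   union has no values, hence is not a union operator. *)
have bigcup_seq (s : seq 'I_m.+1) :
    union_of P (fun x => \bigcup_(j in [set` ord0 :: s]) T j x).
  elim/last_ind: s => [| s j IHs].
    rewrite [X in union_of P X](_ : _ = T ord0) //.
    by apply/funext => x; rewrite set_cons1 bigcup_set1.
  rewrite [X in union_of P X](_ : _ =
      fun x => T j x `|` \bigcup_(i in [set` ord0 :: s]) T i x).
    exact: union_of_setU.
  apply/funext => x; rewrite -bigcup_setU1; congr (\bigcup_(i in _) _).
  apply/seteqP; split=> i /=; rewrite !inE mem_rcons inE.
    by case/or3P=> [-> | /eqP -> | ->]; rewrite ?orbT; [right | left | right].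
  by case=> [-> | /orP[-> | ->]]; rewrite ?eqxx ?orbT.
rewrite [union_op T](_ : _ =
    fun x => \bigcup_(j in [set` ord0 :: enum 'I_m.+1]) T j x) //.
apply/funext => x; congr (\bigcup_(j in _) _).
by apply/seteqP; split=> j //= _; rewrite inE mem_enum orbT.
Qed.

(** In [P k], the index [k] stands for a constant that is [0] for the identity
    and additive under composition. *)
Lemma union_of_composition {K : nmodType} (P : K -> (X -> X) -> Prop)
    (m : nat) (k : 'I_m -> K) (T : 'I_m -> X -> set X) :
    P 0 id ->
    (forall a g, P a g -> nonexpansive g) ->
    (forall a b g h, P a g -> P b h -> P (a + b) (h \o g)) ->
    (forall j, union_of (P (k j)) (T j)) ->
  union_of (P (\sum_(j < m) k j)) (composition T).
Proof.
move=> P0 P_ne P_comp uT; rewrite /composition -big_enum /=.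
elim/last_ind: (enum _) => [|s j IHs].
  by rewrite big_nil; exact: union_of_set1.
rewrite big_rcons /= foldl_rcons.
apply: union_of_comp IHs (uT j); first exact: P_ne.
exact: P_comp.
Qed.

End unions.

(** * Operators of the form (w - b) Id + b N *)

Section classes.
Variables (R : realType) (X : finHilbertType R).
Implicit Types (g h : X -> X) (d e x y : X).

Lemma normB_sqr d e : `|d - e| ^+ 2 = `|d| ^+ 2 - 2 * inner d e + `|e| ^+ 2.
Proof.
have innerDr x y z : inner x (y + z : X) = inner x y + inner x z.
  by rewrite innerC innerDl !(innerC x).
have innerNl x y : inner (- x) (y : X) = - inner x y.
  by rewrite -scaleN1r innerZl mulN1r.
have innerNr x y : inner x (- y : X) = - inner x y.
  by rewrite innerC innerNl innerC.
rewrite -!inner_norm innerDl !innerDr !innerNl !innerNr (innerC e d).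
by ring.
Qed.

(** For [0 < b] this says that [g] is [(w - b) Id + b N] with [N] nonexpansive.
    Allowing any [w], instead of [w = 1], makes room for the partial sums of a
    convex combination; allowing [b = 0] makes room for the empty sum. *)
Definition relaxed (w b : R) g : Prop :=
  forall x y, `|(g x - g y) - (w - b) *: (x - y)| <= b * `|x - y|.

Lemma nonexpansive_relaxed g : nonexpansive g <-> relaxed 1 1 g.
Proof.
by split=> ne_g x y; have := ne_g x y; rewrite subrr scale0r subr0 mul1r.
Qed.

(** Expanding squares, with [d = g x - g y] and [e = x - y], both inequalities
    become [|d|^2 - 2 (1 - a) <e, d> + (1 - 2 a) |e|^2 <= 0], up to a positive
    factor. *)
Lemma averaged_relaxed a g : averaged a g <-> 0 < a < 1 /\ relaxed 1 a g.
Proof.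
have ineq x y : 0 < a < 1 ->
    (`|g x - g y| ^+ 2 + (1 - a) / a * `|(x - g x) - (y - g y)| ^+ 2
      <= `|x - y| ^+ 2)
    = (`|(g x - g y) - (1 - a) *: (x - y)| <= a * `|x - y|).
  move=> /andP[a_gt0 a_lt1].
  have -> : (x - g x) - (y - g y) = (x - y) - (g x - g y).
    by rewrite opprB [g y - y]addrC addrACA opprB [g y - g x]addrC.
  move: (g x - g y) (x - y) => d e.
  rewrite -[in RHS](@ler_pXn2r _ 2) ?nnegrE ?mulr_ge0 ?(ltW a_gt0) //.
  rewrite !normB_sqr.
  rewrite normrZ ger0_norm ?subr_ge0 ?(ltW a_lt1) //.
  rewrite (innerC d (_ *: _)) innerZl.
  rewrite -[in LHS](ler_pM2l a_gt0) mulrDr !mulrA (mulrC a (1 - a)).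
  rewrite mulfK ?lt0r_neq0 //.
  by rewrite -[LHS]subr_ge0 -[RHS]subr_ge0 !exprMn; congr (0 <= _); ring.
split=> -[a01 ag]; split=> // x y; have := ag x y; by rewrite ineq.
Qed.

(** From [a] to [b] the centre of the ball containing [g x - g y] moves by
    [(b - a) (x - y)], and its radius grows by the norm of that vector. *)
Lemma relaxed_le w a b g : a <= b -> relaxed w a g -> relaxed w b g.
Proof.
move=> le_ab ag x y.
have -> : g x - g y - (w - b) *: (x - y) =
    (g x - g y - (w - a) *: (x - y)) + (b - a) *: (x - y).
  rewrite (_ : b - a = (w - a) - (w - b)); last by ring.
  by rewrite (scalerBl (w - a)) addrA subrK.
apply: le_trans (ler_normD _ _) _; rewrite normrZ ger0_norm ?subr_ge0 //.
by have := ag x y; lra.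
Qed.

Lemma relaxed0 : relaxed 0 0 (fun=> 0).
Proof. by move=> x y; rewrite !subrr scale0r subr0 normr0 mul0r. Qed.

Lemma relaxedD w b w' b' g h : relaxed w b g -> relaxed w' b' h ->
  relaxed (w + w') (b + b') (fun x => g x + h x).
Proof.
move=> bg bh x y.
have -> : g x + h x - (g y + h y) - (w + w' - (b + b')) *: (x - y) =
    (g x - g y - (w - b) *: (x - y)) + (h x - h y - (w' - b') *: (x - y)).
  rewrite (_ : w + w' - (b + b') = (w - b) + (w' - b')); last by ring.
  by rewrite scalerDl !opprD (addrACA (g x)) [RHS]addrACA.
apply: le_trans (ler_normD _ _) _; rewrite mulrDl; exact: lerD.
Qed.

Lemma relaxedZ (k w b : R) g : 0 <= k -> relaxed w b g ->
  relaxed (k * w) (k * b) (fun x => k *: g x).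
Proof.
move=> k_ge0 bg x y.
rewrite -scalerBr -mulrBr -scalerA -scalerBr normrZ ger0_norm // -mulrA.
exact: ler_wpM2l.
Qed.

Lemma union_of_combination (m : nat) (w a : 'I_m -> R)
    (T : 'I_m -> X -> set X) :
  (forall j, 0 <= w j) -> (forall j, union_of (relaxed 1 (a j)) (T j)) ->
  union_of (relaxed (\sum_(j < m) w j) (\sum_(j < m) w j * a j))
    (combination w T).
Proof.
move=> w_ge0 uT; rewrite /combination.
elim: (index_enum _) => [|j s IHs].
  rewrite !big_nil [X in union_of _ X](_ : _ = fun=> [set 0]).
    exact/union_of_set1/relaxed0.
  by apply/funext => x; rewrite big_nil.
rewrite !big_cons [X in union_of _ X](_ : _ =
  fun x => minkowski_add (minkowski_scale (w j) (T j x))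
    (\big[@minkowski_add R X/[set 0]]_(i <- s) minkowski_scale (w i) (T i x))).
  apply: union_of_minkowski_add IHs; first exact: relaxedD.
  apply: union_of_minkowski_scale (uT j) => g.
  by move=> /(relaxedZ (w_ge0 j)); rewrite mulr1.
by apply/funext => x; rewrite big_cons.
Qed.

(** * Displacement bounds and composition *)

(** The averagedness inequality multiplied by [s = a / (1 - a)]: without the
    denominator it also makes sense for [s = 0], where it holds for the
    identity, the neutral element of composition. *)
Definition displacement_bounded (s : R) g : Prop :=
  [/\ 0 <= s, nonexpansive g & forall x y,
    `|(x - g x) - (y - g y)| ^+ 2 <= s * (`|x - y| ^+ 2 - `|g x - g y| ^+ 2)].

Lemma averaged_displacement_bounded a g :
  averaged a g <-> 0 < a < 1 /\ displacement_bounded (a / (1 - a)) g.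
Proof.
have ineq (D E U : R) : 0 < a < 1 ->
    (D + (1 - a) / a * U <= E) = (U <= a / (1 - a) * (E - D)).
  move=> /andP[a_gt0 a_lt1]; have b_gt0 : 0 < 1 - a by rewrite subr_gt0.
  rewrite -lerBrDl -(ler_pM2l (divr_gt0 a_gt0 b_gt0)) mulrA.
  rewrite (_ : a / (1 - a) * ((1 - a) / a) = 1) ?mul1r //.
  by field; rewrite !gt_eqF.
split=> [[a01 ag] | [a01 [_ _ ag]]]; split=> //;
  last by move=> x y; rewrite ineq.
have /andP[/ltW a_ge0 /ltW a_le1] := a01.
split=> [|x y|x y]; last by rewrite -ineq.
  by rewrite divr_ge0 ?subr_ge0.
rewrite -(@ler_pXn2r _ 2) ?nnegrE //; apply: le_trans (ag x y).
by rewrite lerDl mulr_ge0 ?exprn_ge0 // divr_ge0 ?subr_ge0.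
Qed.

Lemma displacement_bounded_id : displacement_bounded 0 id.
Proof. by split=> // x y; rewrite !subrr normr0 expr0n mul0r. Qed.

(** The Cauchy-Schwarz inequality for [(sqrt s, sqrt t)] and
    [(sqrt A, sqrt B)], in a form that avoids the roots. *)
Lemma sqr_add_le_mul (s t A B p q : R) : 0 <= s -> 0 <= t -> 0 <= A -> 0 <= B ->
  0 <= p -> 0 <= q ->
  p ^+ 2 <= s * A -> q ^+ 2 <= t * B -> (p + q) ^+ 2 <= (s + t) * (A + B).
Proof.
move=> s0 t0 A0 B0 p0 q0 pA qB.
(* The cross term: [(2 p q)^2 <= 4 (s A) (t B) = 4 (s B) (t A)], which the
   arithmetic-geometric mean inequality bounds by [(s B + t A)^2]. *)
suff : 2 * (p * q) <= s * B + t * A by rewrite sqrrD; nra.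
rewrite -(@ler_pXn2r _ 2) ?nnegrE ?addr_ge0 ?mulr_ge0 //.
have := ler_pM (sqr_ge0 p) (sqr_ge0 q) pA qB.
have := sqr_ge0 (s * B - t * A).
nra.
Qed.

(** The displacement of [h \o g] at [x] is that of [g] at [x] plus that of [h]
    at [g x], while the losses of squared distance telescope through
    [`|g x - g y| ^+ 2]. *)
Lemma displacement_bounded_comp s t g h :
  displacement_bounded s g -> displacement_bounded t h ->
  displacement_bounded (s + t) (h \o g).
Proof.
move=> [s0 ne_g sg] [t0 ne_h th]; split=> [|x y|x y] /=.
- exact: addr_ge0.
- exact: le_trans (ne_h _ _) (ne_g _ _).
have -> : (x - h (g x)) - (y - h (g y)) =
    ((x - g x) - (y - g y)) + ((g x - h (g x)) - (g y - h (g y))).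
  by rewrite [RHS]addrACA -opprD !addrA !subrK.
rewrite -(subrKA (`|g x - g y| ^+ 2) (`|x - y| ^+ 2)).
apply: le_trans (_ : (`|x - g x - (y - g y)|
    + `|g x - h (g x) - (g y - h (g y))|) ^+ 2 <= _).
  by rewrite ler_pXn2r ?nnegrE ?addr_ge0 // ler_normD.
by apply: sqr_add_le_mul => //; rewrite subr_ge0 ler_pXn2r ?nnegrE.
Qed.

End classes.

(** * Unions, convex combinations and compositions of union operators *)

Theorem proposition3p2 (R : realType) (X : finHilbertType R) (m : nat)
    (m_gt0 : (0 < m)%N) :
  (forall (alpha : 'I_m -> R) (T : 'I_m -> X -> set X),
    (forall j, 0 < alpha j < 1) ->
    (forall j, union_averaged (alpha j) (T j)) ->
    [/\ union_averaged (\big[Num.max/0]_(j < m) alpha j) (union_op T),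
        (forall w : 'I_m -> R,
          (forall j, 0 < w j) -> \sum_(j < m) w j = 1 ->
          union_averaged (\sum_(j < m) w j * alpha j) (combination w T)) &
        union_averaged
          (1 + (\sum_(j < m) alpha j / (1 - alpha j))^-1)^-1
          (composition T)])
  /\
  (forall T : 'I_m -> X -> set X,
    (forall j, union_nonexpansive (T j)) ->
    [/\ union_nonexpansive (union_op T),
        (forall w : 'I_m -> R,
          (forall j, 0 < w j) -> \sum_(j < m) w j = 1 ->
          union_nonexpansive (combination w T)) &
        union_nonexpansive (composition T)]).
Proof.
pose j0 := Ordinal m_gt0.
split=> [alpha T alpha01 uT | T uT].
- split.
  + have max01 : 0 < \big[Num.max/0]_(j < m) alpha j < 1.
      have /andP[a_gt0 _] := alpha01 j0.
      rewrite (lt_le_trans a_gt0 (le_bigmax _ _ _)) /=.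
      by apply: bigmax_lt => // j _; have /andP[] := alpha01 j.
    apply: union_of_union_op => // j; apply: union_of_sub (uT j) => g.
    rewrite !averaged_relaxed => -[_ ag]; split=> //.
    exact: relaxed_le (le_bigmax _ _ _) ag.
  + move=> w w_gt0 w1; have w_ge0 j := ltW (w_gt0 j).
    have wa01 : 0 < \sum_(j < m) w j * alpha j < 1.
      have /andP[a_gt0 _] := alpha01 j0.
      rewrite -w1 (bigD1 j0) //= ltr_wpDr ?mulr_gt0 ?sumr_ge0 //=; last first.
        by move=> j _; have /andP[/ltW a_ge0 _] := alpha01 j; rewrite mulr_ge0.
      rewrite [ltRHS](bigD1 j0) //= ltr_leD //.
        by have /andP[_ a_lt1] := alpha01 j0; rewrite gtr_pMr.
      apply: ler_sum => j _; have /andP[_ /ltW a_le1] := alpha01 j.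
      by rewrite ger_pMr.
    apply: union_of_sub (union_of_combination (a := alpha) w_ge0 _).
      by move=> g; rewrite w1 averaged_relaxed.
    by move=> j; apply: union_of_sub (uT j) => g /averaged_relaxed[].
  + set s := \sum_j _.
    have ratio_gt0 j : 0 < alpha j / (1 - alpha j).
      by have /andP[a_gt0 a_lt1] := alpha01 j; rewrite divr_gt0 ?subr_gt0.
    have s_gt0 : 0 < s.
      by rewrite /s (bigD1 j0) //= ltr_wpDr ?sumr_ge0 // => j _; rewrite ltW.
    have a01 : 0 < (1 + s^-1)^-1 < 1.
      rewrite invr_gt0 addr_gt0 ?invr_gt0 //=.
      by rewrite invf_lt1 ?addr_gt0 ?ltrDl ?invr_gt0.
    have sE : (1 + s^-1)^-1 / (1 - (1 + s^-1)^-1) = s.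
      by field; rewrite (addrC s) addrK oner_neq0 !lt0r_neq0 ?addr_gt0.
    apply: (union_of_sub (P := @displacement_bounded R X s)) => [g sg|].
      by apply/averaged_displacement_bounded; rewrite sE.
    apply: union_of_composition.
    * exact: displacement_bounded_id.
    * by move=> a g [].
    * exact: displacement_bounded_comp.
    * move=> j; apply: union_of_sub (uT j) => g.
      by case/averaged_displacement_bounded.
- split.
  + exact: union_of_union_op.
  + move=> w w_gt0 w1; have w_ge0 j := ltW (w_gt0 j).
    apply: union_of_sub (union_of_combination (a := fun=> 1) w_ge0 _).
      move=> g; under [X in relaxed _ X]eq_bigr do rewrite mulr1.
      by rewrite w1 => /nonexpansive_relaxed.
    by move=> j; apply: union_of_sub (uT j) => g /nonexpansive_relaxed.
  + (* Nonexpansiveness involves no constant: all constants are [0]. *)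
    apply: (@union_of_composition _ _ nat
      (fun=> @nonexpansive R X) _ (fun=> 0%N)) => //.
    by move=> _ _ g h ne_g ne_h x y; apply: le_trans (ne_h _ _) (ne_g _ _).
Qed.
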